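(* Let $p\ge 1$ be an integer and let $f:V\to\mathbb{R}$ be a function on a graph $G=(V,E)$. The following conditions are equivalent: (i) $f$ is $p$-weakly peakless; (ii) $f$ satisfies the property $\mathrm{WP}(u,v)$ for any pair of vertices $u,v$ such that $d(u,v)\ge p+1$; (iii) $f$ is locally-$p$-weakly peakless. Moreover, any $p$-weakly peakless function $f$ on a graph $G=(V,E)$ is unimodal on $G^p$.
   Context: Graphs are undirected, connected, without loops or multiple edges, and not necessarily finite. $d(u,v)$ is the standard graph distance. $I(u,v)=\{w: d(u,w)+d(w,v)=d(u,v)\}$ and $I^{\circ}(u,v)=I(u,v)\setminus\{u,v\}$. The $p$th power $G^p$ has the same vertex set as $G$, and two distinct vertices are adjacent in $G^p$ iff their distance in $G$ is at most $p$. A geodesic string is a finite sequence $P=(u=w_0,w_1,\ldots,w_n=v)$ of vertices occurring in this order on some shortest $(u,v)$-path of $G$. A $p$-geodesic between $u$ and $v$ is a geodesic string $(u=w_0,w_1,\ldots,w_n=v)$ with $d(w_i,w_{i+1})\le p$ for $i=0,\ldots,n-1$. A function $f$ is peakless on a geodesic string $P$ if $0\le i<j<k\le n$ implies $f(w_j)\le\max\{f(w_i),f(w_k)\}$, and equality holds only if $f(w_i)=f(w_j)=f(w_k)$. A function $f$ is $p$-weakly peakless if any pair of vertices $u,v$ can be connected by a $p$-geodesic along which $f$ is peakless. $\mathrm{WP}(u,v)$ (for nonadjacent $u\ne v$): there exists $w\in I^{\circ}(u,v)$ such that $f(w)\le\max\{f(u),f(v)\}$, and equality holds only if $f(u)=f(w)=f(v)$.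 A function $f$ is locally-$p$-weakly peakless if it satisfies $\mathrm{WP}(u,v)$ for any $u,v$ with $p+1\le d(u,v)\le 2p$. A function is unimodal on a graph $H$ if every local minimum is global: if $f(v)\le f(y)$ for all neighbors $y$ of $v$ in $H$, then $f(v)\le f(y)$ for all vertices $y$ of $H$.
   Formalization: For infinite graphs (iii) does not imply (ii) in general, so that implication alone is proved assuming f attains its minimum on every nonempty I°(u,v) (automatic if intervals are finite); all other claims are proved without it. *)

(* Defs.v *)
From mathcomp Require Import all_boot all_order all_algebra.
From mathcomp Require Import boolp reals.

Set Implicit Arguments.
Unset Strict Implicit.
Unset Printing Implicit Defensive.

Import Order.TTheory GRing.Theory Num.Theory.

Local Open Scope ring_scope.

(* The vertex set is an arbitrary, possibly infinite, eqType. *)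
Record sgraph := SGraph {
  svertex :> eqType;
  adj : rel svertex;
  adj_sym : symmetric adj;
  adj_irr : irreflexive adj
}.

(* As in path.v, a walk x_0, ..., x_n is given by x_0 and the sequence
   [:: x_1; ...; x_n], so the size of that sequence is the length of the walk. *)
Definition walk (G : sgraph) (u v : G) (q : seq G) : Prop :=
  path (@adj G) u q /\ last u q = v.

Record cgraph := CGraph {
  cgraph_sgraph :> sgraph;
  cgraph_connected : forall u v : cgraph_sgraph, exists q, walk u v q
}.

Definition has_walk (G : sgraph) (u v : G) (n : nat) : bool :=
  `[< exists2 q : seq G, walk u v q & size q = n >].

Lemma has_walk_ex (G : cgraph) (u v : G) : exists n, has_walk u v n.
Proof.
by have [q uv_q] := cgraph_connected u v; exists (size q); apply/asboolP; exists q.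
Qed.

Definition dist (G : cgraph) (u v : G) : nat := ex_minn (has_walk_ex u v).

Lemma has_walk_sym (G : sgraph) (u v : G) n : has_walk u v n -> has_walk v u n.
Proof.
move=> /asboolP[q [uq <-] <-]; apply/asboolP; exists (rev (belast u q)).
  split; last by case: q {uq} => //= a q; rewrite rev_cons last_rcons.
  by rewrite rev_path; apply: sub_path uq => x y; rewrite adj_sym.
by rewrite size_rev size_belast.
Qed.

Lemma dist_sym (G : cgraph) (u v : G) : dist u v = dist v u.
Proof.
rewrite /dist; case: ex_minnP => m um m_min; case: ex_minnP => n vn n_min.
by apply/eqP; rewrite eqn_leq m_min ?n_min //; apply: has_walk_sym.
Qed.

Section Power.
Variables (p : nat) (G : cgraph).

Definition power_adj : rel G := fun u v => (u != v) && (dist u v <= p)%N.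

Lemma power_adj_sym : symmetric power_adj.
Proof. by move=> u v; rewrite /power_adj eq_sym dist_sym. Qed.

Lemma power_adj_irr : irreflexive power_adj.
Proof. by move=> u; rewrite /power_adj eqxx. Qed.

Definition power : sgraph := SGraph power_adj_sym power_adj_irr.

End Power.

Definition geod_itv (G : cgraph) (u v : G) : pred G :=
  [pred w | dist u w + dist w v == dist u v]%N.

Definition geod_oitv (G : cgraph) (u v : G) : pred G :=
  [pred w | [&& w \in geod_itv u v, w != u & w != v]].

Definition shortest_path (G : cgraph) (u v : G) (q : seq G) : Prop :=
  walk u v q /\ size q = dist u v.

(* A string (u = w_0, w_1, ..., w_n) is given by u and s = [:: w_1; ...; w_n];
   its other endpoint is last u s. *)
Definition geodesic_string (G : cgraph) (u : G) (s : seq G) : Prop :=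
  exists2 q, shortest_path u (last u s) q & subseq (u :: s) (u :: q).

Definition p_geodesic (p : nat) (G : cgraph) (u v : G) (s : seq G) : Prop :=
  [/\ last u s = v, geodesic_string u s
    & path (fun x y => dist x y <= p)%N u s].

Section Peakless.
Variables (R : realType) (G : cgraph) (f : G -> R).

Definition no_peak (x y z : G) : Prop :=
  f y <= Num.max (f x) (f z) /\
  (f y = Num.max (f x) (f z) -> f x = f y /\ f y = f z).

Definition peakless (u : G) (s : seq G) : Prop :=
  forall i j k : nat, (i < j)%N -> (j < k)%N -> (k <= size s)%N ->
    no_peak (nth u (u :: s) i) (nth u (u :: s) j) (nth u (u :: s) k).

Definition weakly_peakless (p : nat) : Prop :=
  forall u v : G, exists2 s, p_geodesic p u v s & peakless u s.

Definition WP (u v : G) : Prop :=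
  exists2 w, w \in geod_oitv u v & no_peak u w v.

Definition locally_weakly_peakless (p : nat) : Prop :=
  forall u v : G, (p + 1 <= dist u v <= 2 * p)%N -> WP u v.

(* Automatic when intervals are finite (e.g. G finite or locally finite).
   Without it the local condition does not imply the global one: take p = 1,
   edges u w_i, z_i v, w_i z_i, z_i w_(i+1) for i in nat, f u = f v = 0,
   f w_i = 1 / (2i + 1) and f z_i = 1 / (2i + 2).  WP holds at every pair at
   distance 2, but not at (u, v), which is at distance 3. *)
Definition attains_min_on_intervals : Prop :=
  forall u v : G, (exists w, w \in geod_oitv u v) ->
  exists2 w, w \in geod_oitv u v &
    forall x, x \in geod_oitv u v -> f w <= f x.

End Peakless.

Definition unimodal (R : realType) (H : sgraph) (f : H -> R) : Prop :=
  forall v : H, (forall y : H, adj v y -> f v <= f y) ->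
  forall y : H, f v <= f y.

(* Main.v *)
Require Import Defs.
From mathcomp Require Import all_boot all_order all_algebra.
From mathcomp Require Import boolp reals.
From mathcomp Require Import zify lra.

(** A sequence is peakless exactly when the signs of its successive
    differences form a word of the shape (-)*(0)*(+)*.  So being peakless is a
    local property: it suffices to look at triples of consecutive terms
    ([no_peakP], [peakless_cons]), and likewise a geodesic string can be built
    by adding one vertex at a time ([geodesic_string_cons]).

    The tool for exploiting WP is [WP_approach]: a point w of the open interval
    I°(u, v) that is farther than p from u can be replaced, by WP(u, w), with a
    point strictly closer to u, and this keeps any bound f w < f u, or f w <= c
    with f u <= c.  So w can be brought within distance p of u.

    From WP to peakless geodesics ([WP_weakly_peakless]), let d(u, v) > p, with
    f v <= f u by symmetry, and argue by induction on d(u, v).  If f takes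
    a value below f u on I°(u, v), some w within distance p of u
    satisfies f w < f u; prepending u to a peakless p-geodesic from w to v
    starts with a descent and so creates no peak.  Otherwise f is at least f u
    on I°(u, v), and WP(u, v) forces f v = f u and gives w within distance p of
    u with f w = f u; the next vertex of the geodesic from w to v then has a
    value at least f u, so again there is no peak at w.  Prepending at the
    higher endpoint matters: a first step up from the lower endpoint could be
    followed by a descent.

    From local to global WP ([locally_weakly_peakless_WP]), let d(u, v) > 2p,
    with f v <= f u, and let w minimize f on I°(u, v).  If f w < f u, then w is
    the required point.  Otherwise bring w to a minimizer y within distance p of
    u; then p < d(y, v) < d(u, v), so the induction hypothesis gives
    x in I°(y, v) without a peak at x.  As f x >= f y >= f u >= f v, all these
    values are equal, and x shows WP(u, v).

    Conversely, a p-geodesic between vertices farther than p apart has an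
    interior vertex, which shows WP; and if f y < f v, the second vertex of
    a peakless p-geodesic from v to y is a neighbour of v in the power graph
    where f is smaller than f v. *)

Set Implicit Arguments.
Unset Strict Implicit.
Unset Printing Implicit Defensive.

Import Order.TTheory GRing.Theory Num.Theory.

(** * Distances, intervals and geodesic strings *)

Lemma subseq_cons_split (T : eqType) (y : T) (s t : seq T) :
  subseq (y :: s) t -> exists t1 t2, t = t1 ++ y :: t2 /\ subseq s t2.
Proof.
elim: t => //= a t IHt; case: eqP => [->|_ /IHt[t1 [t2 [-> s_t2]]]].
  by exists [::], t.
by exists (a :: t1), t2.
Qed.

Section Distance.
Variable G : cgraph.
Implicit Types (u v w x : G) (q s : seq G).

Lemma dist_le_walk u v q : walk u v q -> dist u v <= size q.
Proof.
move=> uv_q; rewrite /dist; case: ex_minnP => m _; apply.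
by apply/asboolP; exists q.
Qed.

Lemma shortest_path_ex u v : exists q, shortest_path u v q.
Proof.
rewrite /shortest_path /dist; case: ex_minnP => m /asboolP[q uv_q <-] _.
by exists q.
Qed.

Lemma walk_cat u v w q1 q2 : walk u v q1 -> walk v w q2 -> walk u w (q1 ++ q2).
Proof.
by move=> [uq1 <-] [vq2 <-]; split; rewrite ?cat_path ?uq1 ?last_cat.
Qed.

Lemma distxx u : dist u u = 0.
Proof. by apply/eqP; rewrite -leqn0; apply: (@dist_le_walk u u [::]). Qed.

Lemma dist_gt0 u v : (0 < dist u v) = (u != v).
Proof.
have [->|] := eqVneq u v; first by rewrite distxx.
have [[|x q] [[_ <-] <-]] := shortest_path_ex u v; last by [].
by rewrite eqxx.
Qed.

Lemma dist_triangle v u w : dist u w <= dist u v + dist v w.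
Proof.
have [q1 [uv_q1 <-]] := shortest_path_ex u v.
have [q2 [vw_q2 <-]] := shortest_path_ex v w.
by rewrite -size_cat; apply/dist_le_walk/(walk_cat uv_q1).
Qed.

Lemma geod_itv_sym u v w : (w \in geod_itv u v) = (w \in geod_itv v u).
Proof.
by rewrite !inE addnC (dist_sym w v) (dist_sym u w) (dist_sym u v).
Qed.

Lemma geod_oitv_sym u v w : (w \in geod_oitv u v) = (w \in geod_oitv v u).
Proof. by rewrite !(inE, geod_itv_sym u v) [(w != v) && _]andbC. Qed.

Lemma geod_oitvP u v w : reflect
  [/\ dist u w + dist w v = dist u v, 0 < dist u w & 0 < dist w v]
  (w \in geod_oitv u v).
Proof.
rewrite !inE !dist_gt0 eq_sym (eq_sym w u).
by apply: (iffP and3P) => -[/eqP ? ? ?]; split=> //; apply/eqP.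
Qed.

Lemma geod_oitv_subl u v w x :
  x \in geod_oitv u w -> w \in geod_oitv u v -> x \in geod_oitv u v.
Proof.
move=> /geod_oitvP[xw x0 w0] /geod_oitvP[wv w0' v0]; apply/geod_oitvP.
by have := dist_triangle w x v; have := dist_triangle x u v; split; lia.
Qed.

Lemma geod_oitv_subr u v w x :
  w \in geod_oitv u v -> x \in geod_oitv w v -> x \in geod_oitv u v.
Proof.
by rewrite !(geod_oitv_sym _ v) => uw wx; apply: geod_oitv_subl wx uw.
Qed.

(** Being a geodesic string is a condition on distances alone: shortest paths
    through consecutive vertices can be chosen independently, and their
    concatenation is shortest because the distances add up. *)
Lemma geodesic_string_cons u w s :
  geodesic_string u (w :: s) <->
  [/\ u != w, w \in geod_itv u (last w s) & geodesic_string w s].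
Proof.
set v := last w s; split.
  case=> q [[uq q_v] q_d]; rewrite /= eqxx => /subseq_cons_split[q1 [q2 [q_E s_q2]]].
  move: uq q_v q_d; rewrite q_E -cat_rcons cat_path last_cat last_rcons size_cat.
  case/andP=> uq1 wq2 q2_v; rewrite size_rcons => q_d.
  have uw : dist u w <= (size q1).+1.
    by rewrite -(size_rcons q1 w); apply: dist_le_walk; split; rewrite ?last_rcons.
  have wv : dist w v <= size q2 by apply: dist_le_walk.
  have uwv := dist_triangle w u v.
  have {}q_d : (size q1).+1 + size q2 = dist u v by [].
  (* Both parts of the path are shortest: their lengths add up to d(u, v). *)
  split; [|by rewrite inE; apply/eqP; lia|].
    by apply/eqP=> uw_E; move: q_d wv; rewrite uw_E; lia.
  exists q2; last by rewrite /= eqxx.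
  by split; [|rewrite -/v; lia].
case=> u_w; rewrite inE => /eqP uwv [q2 [wv_q2 q2_d] s_q2].
have [q1 [uw_q1 q1_d]] := shortest_path_ex u w.
exists (q1 ++ q2).
  split; first exact: walk_cat uw_q1 wv_q2.
  by rewrite size_cat q1_d q2_d.
case/lastP: q1 uw_q1 {q1_d} => [[_ /= uw]|q1 y [_]].
  by rewrite uw eqxx in u_w.
rewrite last_rcons => ->; rewrite cat_rcons -[u :: _]cat1s -[u :: _ ++ _]cat1s.
by apply: cat_subseq => //; apply: subseq_trans s_q2 (suffix_subseq _ _).
Qed.

Lemma shortest_path_rev u v q :
  shortest_path u v q -> shortest_path v u (rev (belast u q)).
Proof.
move=> [[uq <-] q_d]; split; last by rewrite size_rev size_belast q_d dist_sym.
split; last by case: q {uq q_d} => //= a q; rewrite rev_cons last_rcons.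
by rewrite rev_path; apply: sub_path uq => x y; rewrite adj_sym.
Qed.

Lemma last_rev_belast u s : last (last u s) (rev (belast u s)) = u.
Proof. by case: s => //= a s; rewrite rev_cons last_rcons. Qed.

Lemma cons_rev_belast u s : last u s :: rev (belast u s) = rev (u :: s).
Proof. by rewrite (lastI u) rev_rcons. Qed.

Lemma p_geodesic_rev p u v s :
  p_geodesic p u v s -> p_geodesic p v u (rev (belast u s)).
Proof.
move=> [<- [q uq s_q] us]; split; first exact: last_rev_belast.
  exists (rev (belast u q)); first by rewrite last_rev_belast; apply: shortest_path_rev.
  have [[_ uq_v] _] := uq.
  by rewrite cons_rev_belast -uq_v cons_rev_belast subseq_rev.
by rewrite rev_path; apply: sub_path us => x y; rewrite dist_sym.
Qed.

End Distance.

Local Open Scope ring_scope.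

(** * Peaks and property WP *)

Section Peaks.
Variables (R : realType) (G : cgraph) (f : G -> R).
Implicit Types (u v w x y z : G) (s : seq G).

(** These are the pairs of differences with nondecreasing signs; eliminating the
    maximum turns questions about peaks into linear arithmetic. *)
Lemma no_peakP x y z :
  no_peak f x y z <-> [\/ f y < f x, f y < f z | f x = f y /\ f y = f z].
Proof.
rewrite /no_peak; have [xz|zx] := leP (f x) (f z); split.
- move=> [yz eq_yz]; have [|y_z] := eqVneq (f y) (f z).
    by constructor 3; apply: eq_yz.
  by constructor 2; rewrite lt_neqAle y_z.
- by case=> [| |[]]; split; lra.
- move=> [yx eq_yx]; have [|y_x] := eqVneq (f y) (f x).
    by constructor 3; apply: eq_yx.
  by constructor 1; rewrite lt_neqAle y_x.
- by case=> [| |[]]; split; lra.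
Qed.

Lemma no_peak_sym x y z : no_peak f x y z -> no_peak f z y x.
Proof.
move=> /no_peakP xyz; apply/no_peakP.
by case: xyz => [yx|yz|[-> ->]]; [constructor 2|constructor 1|constructor 3].
Qed.

(** Since the signs of the differences along x, y, z, t are nondecreasing, any
    term may be dropped; [no_peak_subr] drops z and [no_peak_subl] drops y. *)
Lemma no_peak_subr x y z t :
  no_peak f x y z -> no_peak f y z t -> no_peak f x y t.
Proof.
move=> /no_peakP xyz /no_peakP yzt; apply/no_peakP.
case: xyz => [yx|yz|[xy yz]]; first by constructor 1.
  by constructor 2; case: yzt => [|zt|[]]; lra.
by case: yzt => [|zt|[_ zt]]; [constructor 1|constructor 2|constructor 3; split]; lra.
Qed.

Lemma no_peak_subl x y z t :
  no_peak f x y z -> no_peak f y z t -> no_peak f x z t.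
Proof.
by move=> /no_peak_sym xyz /no_peak_sym yzt; apply/no_peak_sym/no_peak_subr/xyz.
Qed.

Lemma peakless_cons u w x s :
  no_peak f u w x -> peakless f w (x :: s) -> peakless f u [:: w, x & s].
Proof.
move=> uwx pl_wxs; pose a := nth u [:: w, x & s].
have a_pl i j k : (i < j)%N -> (j < k)%N -> (k <= (size s).+1)%N ->
    no_peak f (a i) (a j) (a k).
  move=> ij jk ks; rewrite /a -!(set_nth_default _ w) /=; try lia.
  exact: pl_wxs.
have uw_a m : (0 < m)%N -> (m <= (size s).+1)%N -> no_peak f u w (a m).
  case: m => [|[|m]] // _ ms; apply: no_peak_subr uwx _.
  exact: (a_pl 0%N 1%N m.+2).
case=> [|i] [|j] [|k] //= ij jk ks; last exact: a_pl.
case: j => [|j] in ij jk *; first exact: uw_a.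
by apply: (@no_peak_subl _ w); [apply: uw_a; lia|apply: (a_pl 0%N)].
Qed.

Lemma peakless_rev u s :
  peakless f u s -> peakless f (last u s) (rev (belast u s)).
Proof.
move=> pl i j k ij jk; rewrite cons_rev_belast size_rev size_belast => ks.
rewrite !(set_nth_default u) ?size_rev /=; try lia.
rewrite !nth_rev /=; try lia.
by apply/no_peak_sym/pl; lia.
Qed.

Lemma WP_sym u v : WP f u v -> WP f v u.
Proof.
by case=> w uv_w uwv; exists w; [rewrite geod_oitv_sym|apply: no_peak_sym].
Qed.

(** Repeating WP at (u, w) moves w towards u inside the interval until it comes
    within distance p.  The predicate P stands for an upper bound on f, which
    the absence of a peak at the new point carries over. *)
Lemma WP_approach (p : nat) u v (P : G -> Prop) :
    (forall x, x \in geod_oitv u v -> (p < dist u x)%N -> WP f u x) ->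
    (forall x y, P x -> no_peak f u y x -> P y) ->
  forall w, w \in geod_oitv u v -> P w ->
    exists2 y, y \in geod_oitv u v & (dist u y <= p)%N /\ P y.
Proof.
move=> wp P_closed w.
have [n] := ubnP (dist u w); elim: n w => // n IHn w w_n uv_w Pw.
have [|p_w] := leqP (dist u w) p; first by exists w.
have [y uw_y uyw] := wp w uv_w p_w.
have [uyw_d _ y_w] := geod_oitvP _ _ _ uw_y.
by apply: (IHn y); [lia|apply: geod_oitv_subl uv_w|apply: P_closed uyw].
Qed.

End Peaks.

(** * The equivalences and unimodality *)

Section Main.
Variables (R : realType) (p : nat) (G : cgraph) (f : G -> R).
Implicit Types (u v w x y : G) (s : seq G).

(** The second vertex of a peakless p-geodesic from u to v works: a step of
    length at most p cannot reach v. *)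
Lemma weakly_peakless_WP u v :
  weakly_peakless f p -> (p < dist u v)%N -> WP f u v.
Proof.
move=> /(_ u v)[s [s_v us p_us] pl] uv_p.
case: s => [|x [|y s]] in s_v us p_us pl.
- by move: uv_p; rewrite -s_v distxx.
- by move: p_us uv_p; rewrite -s_v /= andbT => ? ?; lia.
have /geodesic_string_cons[u_x ux_v] := us.
case/geodesic_string_cons => x_y; rewrite -dist_gt0 in x_y.
rewrite -dist_gt0 in u_x; move: ux_v; rewrite /= in s_v *.
rewrite s_v !inE => /eqP uxv /eqP xyv.
exists x; first by apply/geod_oitvP; split; lia.
have := pl 0%N 1%N (size s).+2 isT isT (leqnn _).
by rewrite [nth _ _ _.+2]nth_last /= s_v.
Qed.

(** Induction on d(u, v): prepend u, taken as the higher endpoint, to a peakless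
    p-geodesic starting at a suitable w within distance p of u. *)
Lemma WP_weakly_peakless :
  (forall u v, (p < dist u v)%N -> WP f u v) -> weakly_peakless f p.
Proof.
move=> wp u v; have [n] := ubnP (dist u v); elim: n u v => // n IHn u v uv_n.
wlog vu : u v uv_n / f v <= f u.
  move=> wlog_vu; have [|/ltW uv] := leP (f v) (f u); first exact: wlog_vu.
  have [|s vs pl] := wlog_vu v u _ uv; first by rewrite dist_sym.
  have [s_u _ _] := vs; exists (rev (belast v s)); first exact: p_geodesic_rev.
  by rewrite -s_u; apply: peakless_rev.
have [uv_p|p_uv] := leqP (dist u v) p.
  have [q uv_q] := shortest_path_ex u v.
  have [uv|u_v] := eqVneq u v.
    exists [::]; last by case=> [|i] [|j] [|k].
    by split=> //; exists q; rewrite /= ?eqxx ?sub0seq // {2}uv.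
  exists [:: v]; last by case=> [|i] [|[|j]] [|[|k]].
  split=> //=; last by rewrite uv_p.
  exists q => //=; rewrite eqxx sub1seq.
  have [[_ q_v] _] := uv_q; have := mem_last u q.
  by rewrite q_v inE eq_sym (negPf u_v).
(* The first step w either descends strictly, or stays level with f u, in which
   case f u = f v is a lower bound of f on the whole interval. *)
have [w uv_w [uw_p uw]] : exists2 w, w \in geod_oitv u v & (dist u w <= p)%N /\
    (f w < f u \/ [/\ f w = f u, f v = f u &
      forall x, x \in geod_oitv u v -> f u <= f x]).
  have approach P := @WP_approach R G f p u v P (fun x _ => wp u x).
  have [[w uv_w wu]|minu] := pselect (exists2 w, w \in geod_oitv u v & f w < f u).
    have [|y uv_y [uy_p yu]] := approach (fun x => f x < f u) _ w uv_w wu.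
      by move=> x y xu /no_peakP[||[]]; lra.
    by exists y => //; split=> //; left.
  have {}minu x : x \in geod_oitv u v -> f u <= f x.
    by move=> uv_x; rewrite leNgt; apply/negP => xu; apply: minu; exists x.
  have [w uv_w /no_peakP uwv] := wp u v p_uv.
  have u_w := minu w uv_w.
  have [wu vu_E] : f w = f u /\ f v = f u by case: uwv => [||[]]; split; lra.
  have [||y uv_y [uy_p yu]] := approach (fun x => f x <= f u) _ w uv_w.
  - by move=> x y xu /no_peakP[||[]]; lra.
  - by rewrite wu.
  have := minu y uv_y; exists y => //; split=> //; right; split=> //; lra.
have [uwv u_w w_v] := geod_oitvP _ _ _ uv_w.
have [|s [s_v ws p_ws] pl] := IHn w v; first by lia.
exists (w :: s).
  split=> //=; last by rewrite uw_p.
  apply/geodesic_string_cons; split=> //; first by rewrite -dist_gt0.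
  by rewrite s_v inE uwv.
case: s => [|x s] in s_v ws p_ws pl *.
  by move: w_v; rewrite -s_v distxx.
apply: peakless_cons => //; apply/no_peakP.
case: uw => [|[wu vu_E minu]]; first by constructor 1.
have /geodesic_string_cons[w_x] := ws.
rewrite -dist_gt0 in w_x; rewrite /= in s_v; rewrite s_v inE => /eqP wxv _.
(* The first two values are both f u, so a peak at w would need f x < f u. *)
suff: f u <= f x.
  rewrite le_eqVlt => /orP[/eqP ux|ux]; first by constructor 3; split; lra.
  by constructor 2; lra.
have [->|x_v] := eqVneq x v; first by rewrite vu_E.
apply/minu/(geod_oitv_subr uv_w)/geod_oitvP.
by split; rewrite // dist_gt0.
Qed.

(** A minimizer near u, the higher endpoint, leaves the pair (y, v) farther than
    p apart; WP(y, v) then cannot go below the minimum, which makes all values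
    equal. *)
Lemma locally_weakly_peakless_WP u v :
  (0 < p)%N -> attains_min_on_intervals f -> locally_weakly_peakless f p ->
  (p < dist u v)%N -> WP f u v.
Proof.
move=> p_gt0 attains_min loc.
have [n] := ubnP (dist u v); elim: n u v => // n IHn u v uv_n p_uv.
wlog vu : u v uv_n p_uv / f v <= f u.
  move=> wlog_vu; have [|/ltW uv] := leP (f v) (f u); first exact: wlog_vu.
  by apply/WP_sym/wlog_vu; rewrite // dist_sym.
have [uv_2p|p2_uv] := leqP (dist u v) (2 * p); first by apply: loc; lia.
(* The interior of the interval is nonempty, since d(u, v) > 2p >= 2. *)
have [|w uv_w min_w] := attains_min u v.
  have [[|x [|y q]] [[uq q_v] q_d]] := shortest_path_ex u v; rewrite /= in q_d; try lia.
  have us : geodesic_string u [:: x, y & q].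
    by exists [:: x, y & q] => //; split=> //; rewrite q_v.
  exists x; move/geodesic_string_cons: us => -[u_x uxv].
  move/geodesic_string_cons => -[x_y]; rewrite /= in q_v uxv *.
  move: uxv u_x x_y; rewrite q_v -!dist_gt0 !inE => /eqP uxv u_x x_y /eqP xyv _.
  by apply/geod_oitvP; split; lia.
have [wu|uw] := ltP (f w) (f u); first by exists w => //; apply/no_peakP; constructor 1.
have [||y uv_y [uy_p yw]] :=
    @WP_approach R G f p u v (fun x => f x <= f w) _ _ w uv_w (lexx _).
- by move=> x /geod_oitvP[uxv _ x_v]; apply: IHn; lia.
- by move=> x y xw /no_peakP[||[]]; lra.
have [uyv u_y y_v] := geod_oitvP _ _ _ uv_y.
have [||x yv_x /no_peakP yxv] := IHn y v; try lia.
have uv_x := geod_oitv_subr uv_y yv_x.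
have := min_w x uv_x; have := min_w y uv_y => wy wx.
by exists x => //; apply/no_peakP; case: yxv => [||[]]; try constructor 3; lra.
Qed.

(** If f y < f v, the second vertex x of a peakless p-geodesic from v to y
    satisfies f x < f v, and x is within distance p of v. *)
Lemma weakly_peakless_unimodal :
  weakly_peakless f p -> @unimodal R (power p G) f.
Proof.
move=> wpl v min_v y; have [s [s_y _ p_vs] pl] := wpl v y.
case: s => [|x s] in s_y p_vs pl *; first by rewrite -s_y.
have vx : f v <= f x.
  have [->//|v_x] := eqVneq v x; apply: min_v.
  by case/andP: p_vs => vx_p _; rewrite /= /power_adj v_x vx_p.
case: s => [|z s] in s_y p_vs pl *; first by rewrite -s_y.
have := pl 0%N 1%N (size s).+2 isT isT (leqnn _).
rewrite [nth _ _ _.+2]nth_last; rewrite /= in s_y *; rewrite s_y.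
by move=> /no_peakP[||[]]; lra.
Qed.

End Main.

Theorem theorem11 (R : realType) (p : nat) (hp : (1 <= p)%N) (G : cgraph)
    (f : G -> R) :
  ((weakly_peakless f p <->
      (forall u v : G, (p + 1 <= dist u v)%N -> WP f u v)) /\
   ((forall u v : G, (p + 1 <= dist u v)%N -> WP f u v) ->
      locally_weakly_peakless f p) /\
   (attains_min_on_intervals f -> locally_weakly_peakless f p ->
      (forall u v : G, (p + 1 <= dist u v)%N -> WP f u v))) /\
  (weakly_peakless f p -> @unimodal R (power p G) f).
Proof.
rewrite addn1; split; last exact: weakly_peakless_unimodal.
split; [split|split].
- by move=> wpl u v; apply: weakly_peakless_WP.
- exact: WP_weakly_peakless.
- by move=> wp u v /andP[+ _]; rewrite addn1; apply: wp.
- by move=> attains_min loc u v; apply: locally_weakly_peakless_WP.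
Qed.
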